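(* Let $D$ be an integral domain with polynomial ring $D[X]$, and let $N_v=\{h\in D[X]\mid c(h)_v=D\}$. (A) The following conditions are equivalent: (1) $t\text{-Max}(D)$ is independent, and each upper to zero in $D[X]$ is contained in a unique maximal $t$-ideal of $D[X]$; (2) $t\text{-Max}(D[X])$ is independent; (3) $\operatorname{Max}(D[X]_{N_v})$ is independent. (B) The following conditions are equivalent: (1) $D$ is weakly Matlis, and each upper to zero in $D[X]$ is contained in a unique maximal $t$-ideal of $D[X]$; (2) $D[X]$ is weakly Matlis; (3) $D[X]_{N_v}$ is $h$-local.
   Context: For a domain $D$ with quotient field $K$ and a nonzero fractional ideal $I$: $I^{-1}=\{x\in K\mid xI\subseteq D\}$, $I_v=(I^{-1})^{-1}$, and $I_t=\bigcup J_v$, the union being over all nonzero finitely generated subideals $J$ of $I$. $I$ is a $t$-ideal if $I=I_t$. A maximal $t$-ideal is a maximal element of the set of proper integral $t$-ideals; it is a prime ideal, and each nonzero nonunit lies in one. $t\text{-Max}(D)$ is the set of maximal $t$-ideals of $D$, and $\operatorname{Max}(R)$ is the set of maximal ideals of $R$. For $h\in K[X]$, $c(h)$ is the $D$-ideal generated by the coefficients of $h$. A set $\Lambda$ of prime ideals of a domain has finite character if each nonzero element of the domain belongs to at most finitely many members of $\Lambda$; it is independent if no two (distinct) members of $\Lambda$ contain a common nonzero prime ideal. A domain $R$ is $h$-local if $\operatorname{Max}(R)$ is independent of finite character, and weakly Matlis if $t\text{-Max}(R)$ is independent of finite character. An upper to zero in $D[X]$ is a nonzero prime ideal $Q$ of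 $D[X]$ with $Q\cap D=(0)$. *)

(* Defs.v *)
From HB Require Import structures.
From mathcomp Require Import all_boot all_order all_algebra.
From mathcomp Require Import boolp classical_sets cardinality.

Set Implicit Arguments.
Unset Strict Implicit.
Unset Printing Implicit Defensive.

Import GRing.Theory.

Local Open Scope ring_scope.
Local Open Scope classical_set_scope.

Notation "x %:F" := (@FracField.tofrac _ x) (at level 1, format "x %:F") : ring_scope.

(** Ideals of an integral domain, as classical sets.  All ideals below are
    proper: [idealr_closed] of MathComp includes [1 \notin I]. *)
Section Ideals.
Variable R : idomainType.
Implicit Types (I P M : set R) (L : set (set R)).

Definition is_proper_ideal I : Prop := idealr_closed [in I].

Definition is_prime_ideal P : Prop :=
  is_proper_ideal P /\ prime_idealr_closed [in P].

Definition nonzero_ideal I : Prop := exists2 x, I x & x != 0.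

Definition Max : set (set R) :=
  [set M | is_proper_ideal M /\
           forall I, is_proper_ideal I -> M `<=` I -> I = M].

Definition finite_character L : Prop :=
  forall x : R, x != 0 -> finite_set [set P | L P /\ P x].

Definition independent L : Prop :=
  forall M N, L M -> L N -> M <> N ->
    ~ exists P, [/\ is_prime_ideal P, nonzero_ideal P, P `<=` M & P `<=` N].

End Ideals.

(** The operations [I |-> I^-1, I_v, I_t] on subsets of the quotient field.
    They are meaningful for nonzero fractional ideals only: for instance
    [v_closure [set 0]] is the whole field when [D] is a field. *)
Section StarOperations.
Variable D : idomainType.
Local Notation K := {fraction D}.
Implicit Types I J : set K.

Definition base_ring : set K := range (@FracField.tofrac D).

Definition ideal_inv I : set K := [set x | forall y, I y -> base_ring (x * y)].

Definition v_closure I : set K := ideal_inv (ideal_inv I).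

Definition D_span (s : seq K) : set K :=
  [set x | exists a : 'I_(size s) -> D, x = \sum_i (a i)%:F * s`_i].

Definition t_closure I : set K :=
  [set x | exists s : seq K,
     [/\ D_span s `<=` I, D_span s <> [set 0] & v_closure (D_span s) x]].

Definition content (h : {poly K}) : set K := D_span h.

Definition is_proper_t_ideal (I : set D) : Prop :=
  [/\ is_proper_ideal I, nonzero_ideal I &
      t_closure [set x%:F | x in I] = [set x%:F | x in I]].

Definition tMax : set (set D) :=
  [set M | is_proper_t_ideal M /\
           forall N : set D, is_proper_t_ideal N -> M `<=` N -> N = M].

(** [h != 0] is not redundant, see the remark above on [v_closure [set 0]]. *)
Definition Nv_set : set {poly D} :=
  [set h | h != 0 /\
     v_closure (content (map_poly (@FracField.tofrac D) h)) = base_ring].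

Definition is_upper_to_zero (Q : set {poly D}) : Prop :=
  [/\ is_prime_ideal Q, nonzero_ideal Q & forall a : D, Q a%:P -> a = 0].

End StarOperations.

Definition h_local (R : idomainType) : Prop :=
  independent (@Max R) /\ finite_character (@Max R).

Definition weakly_Matlis (R : idomainType) : Prop :=
  independent (@tMax R) /\ finite_character (@tMax R).

(** The localization of a domain at a multiplicative subset, as the subring
    [{a / s | s \in S}] of the quotient field. *)
Record multSubset (R : idomainType) := MultSubset {
  mult_set : set R;
  mult_set1 : mult_set 1;
  mult_setM : forall s t, mult_set s -> mult_set t -> mult_set (s * t);
  mult_set0 : ~ mult_set 0
}.

Section Localization.
Variables (R : idomainType) (S : multSubset R).

Definition is_fraction : {pred {fraction R}} :=
  fun x => `[< exists a s : R, mult_set S s /\ x = a%:F / s%:F >].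

Lemma mult_set_neq0 s : mult_set S s -> s%:F != 0.
Proof.
by move=> Ss; rewrite tofrac_eq0; apply/eqP => s0; apply: (mult_set0 (m := S));
  rewrite -s0.
Qed.

Lemma is_fraction_subring : subring_closed is_fraction.
Proof.
split.
- apply/asboolP; exists 1, 1; split; first exact: mult_set1.
  by rewrite tofrac1 divr1.
- move=> x y /asboolP[a [s [Ss ->]]] /asboolP[b [t [St ->]]]; apply/asboolP.
  exists (a * t - b * s), (s * t); split; first exact: mult_setM.
  have s0 := mult_set_neq0 Ss; have t0 := mult_set_neq0 St.
  by rewrite -mulNr addf_div // tofracB !tofracM mulNr.
- move=> x y /asboolP[a [s [Ss ->]]] /asboolP[b [t [St ->]]]; apply/asboolP.
  exists (a * b), (s * t); split; first exact: mult_setM.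
  by rewrite mulf_div !tofracM.
Qed.

HB.instance Definition _ :=
  GRing.isSubringClosed.Build {fraction R} is_fraction is_fraction_subring.

Definition localization := {x : {fraction R} | is_fraction x}.

HB.instance Definition _ := SubChoice.on localization.
HB.instance Definition _ :=
  [SubChoice_isSubComNzRing of localization by <:].

Definition loc_unit : {pred localization} :=
  fun x => (val x != 0) && is_fraction (val x)^-1.

Definition loc_inv (x : localization) : localization := insubd x (val x)^-1.

Lemma loc_mulVr : {in loc_unit, left_inverse 1 loc_inv *%R}.
Proof.
move=> x /andP[x0 xV]; apply: val_inj.
by rewrite rmorphM rmorph1 /loc_inv /= insubdK // mulVf.
Qed.

Lemma loc_unitP (x y : localization) : y * x = 1 -> x \in loc_unit.
Proof.
move=> /(congr1 val); rewrite rmorphM rmorph1 /= => yx.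
have x0 : val x != 0.
  by apply/eqP => x0; move/eqP: yx; rewrite x0 mulr0 eq_sym oner_eq0.
apply/andP; split=> //.
suff -> : (val x)^-1 = val y by exact: (valP y).
by apply: (mulIf x0); rewrite mulVf.
Qed.

Lemma loc_inv_out : {in [predC loc_unit], loc_inv =1 id}.
Proof.
move=> x; rewrite inE negb_and negbK => /orP[/eqP x0|xV]; apply: val_inj.
  by rewrite /loc_inv val_insubd x0 invr0; case: ifP.
by rewrite /loc_inv val_insubd; move: xV; rewrite /in_mem /= => /negbTE ->.
Qed.

HB.instance Definition _ := GRing.ComNzRing_hasMulInverse.Build localization
  loc_mulVr loc_unitP loc_inv_out.

Lemma loc_integral (x y : localization) : x * y = 0 -> (x == 0) || (y == 0).
Proof.
move=> /(congr1 val)/eqP; rewrite rmorphM rmorph0 mulf_eq0.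
by rewrite -!val_eqE.
Qed.

HB.instance Definition _ :=
  GRing.ComUnitRing_isIntegral.Build localization loc_integral.

End Localization.

(** The set [N_v] is multiplicative.  This follows from: if [g] has
    coefficients in [D] and [(c g)^-1 = D], then [g f] in [D[X]] implies
    [f] in [D[X]]. *)
Section NvMultiplicative.
Variable D : idomainType.
Local Notation K := {fraction D}.
Local Notation A := (@base_ring D).
Implicit Types (T : set K) (s : seq K) (f g : {poly K}).

Lemma base_ring1 : A 1. Proof. by exists 1 => //; rewrite tofrac1. Qed.
Lemma base_ring0 : A 0. Proof. by exists 0 => //; rewrite tofrac0. Qed.
Lemma base_ringM x y : A x -> A y -> A (x * y).
Proof. by move=> [a _ <-] [b _ <-]; exists (a * b) => //; rewrite tofracM. Qed.
Lemma base_ringB x y : A x -> A y -> A (x - y).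
Proof. by move=> [a _ <-] [b _ <-]; exists (a - b) => //; rewrite tofracB. Qed.

Definition is_submod T :=
  [/\ T 0, forall x y, T x -> T y -> T (x - y) &
      forall a x, A a -> T x -> T (a * x)].

Lemma submodD T x y : is_submod T -> T x -> T y -> T (x + y).
Proof.
move=> [T0 TB _] Tx Ty; rewrite -[y]opprK -[- y]sub0r.
by apply: (TB _ _ Tx); apply: TB.
Qed.

(* The elements [x] such that [I ^ n * x] is contained in [T] for some [n],
   where [I] is the ideal generated by [s]. *)
Inductive sat s T : K -> Prop :=
  | sat_base x : T x -> sat s T x
  | sat_step x : (forall c, c \in s -> sat s T (c * x)) -> sat s T x.

Lemma sat_mul s T a x : is_submod T -> A a -> sat s T x -> sat s T (a * x).
Proof.
move=> [_ _ TM] Aa; elim=> {}x; first by move=> Tx; apply/sat_base/TM.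
by move=> _ IH; apply: sat_step => c cs; rewrite mulrCA; apply: IH.
Qed.

Lemma sat_sub s T : is_submod T -> (forall c, c \in s -> A c) ->
  is_submod (sat s T).
Proof.
move=> Tm sA; have [T0 TB TM] := Tm; split.
- exact: sat_base.
- move=> x y satx; elim: satx y => {}x.
    move=> Tx y saty; elim: saty x Tx => {}y.
      by move=> Ty x Tx; apply/sat_base/TB.
    move=> _ IH x Tx; apply: sat_step => c cs.
    by rewrite mulrBr; apply: IH => //; apply: TM => //; apply: sA.
  move=> _ IH y saty; apply: sat_step => c cs.
  by rewrite mulrBr; apply: IH => //; apply: sat_mul => //; apply: sA.
- by move=> a x; apply: sat_mul.
Qed.

Lemma sat_sat s c T x : is_submod T -> (forall d, d \in c :: s -> A d) ->
  sat s (sat (c :: s) T) x -> sat (c :: s) T (c * x) -> sat (c :: s) T x.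
Proof.
move=> Tm sA; elim=> {}x // _ IH satcx; apply: sat_step => d.
rewrite inE => /predU1P[->//|ds]; apply: IH => //.
rewrite mulrCA; apply: sat_mul => //; apply: sA.
by rewrite inE ds orbT.
Qed.

Lemma sat_poly s T f : is_submod T -> (forall c, c \in s -> A c) ->
  (forall i, T (Poly s * f)`_i) -> forall i, sat s T f`_i.
Proof.
elim: s T f => [|c s IHs] T f Tm sA Tsf.
  by move=> i; exact: sat_step.
have Ac : A c by apply: sA; rewrite inE eqxx.
have sA' d : d \in s -> A d by move=> ds; apply: sA; rewrite inE ds orbT.
have Um := sat_sub Tm sA; have [U0 UB UM] := Um; have [T0 TB TM] := Tm.
have Apoly i : A (Poly (c :: s))`_i.
  rewrite coef_Poly; case: (ltnP i (size (c :: s))) => [lti|gei].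
    by apply: sA; rewrite mem_nth.
  by rewrite nth_default //; exact: base_ring0.
suff gen a : A a -> (forall i, T (a%:P * (Poly (c :: s) * f))`_i) ->
    forall j, sat (c :: s) T (a%:P * f)`_j.
  by have := gen 1 base_ring1; rewrite !mul1r; apply.
elim/poly_ind: f {Tsf} a => [|f b IHf] a Aa Tf j.
  by rewrite mulr0 coef0; apply: sat_base.
set F := a%:P * (f * 'X + b%:P) in Tf *.
have TF i : T (Poly (c :: s) * F)`_i by rewrite /F mulrCA; apply: Tf.
have F0 : F`_0 = a * b by rewrite /F coefCM coefD coefMX coefC eqxx add0r.
have FS k : F`_k.+1 = a * f`_k by rewrite /F coefCM coefD coefMX coefC /= addr0.
have Tcb : T (c * (a * b)).
  have := TF 0%N; rewrite coefM big_ord1 F0 /=.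
  by rewrite cons_poly_def coefD coefMX coefC eqxx add0r.
suff satc k : sat (c :: s) T (c * F`_k).
  apply: (sat_sat Tm sA) => //; apply: IHs => // k.
  have := UB _ _ (sat_base (c :: s) (TF k.+1)) (satc k.+1).
  rewrite /= cons_poly_def mulrDl mulrAC coefD coefMX /= coefCM.
  by rewrite addrK.
case: k => [|k]; first by rewrite F0; exact: sat_base.
rewrite FS mulrA -coefCM; apply: IHf; first exact: base_ringM.
move=> i.
have -> : ((c * a)%:P * (Poly (c :: s) * f))`_i =
    c * (Poly (c :: s) * F)`_i.+1 - (Poly (c :: s))`_i.+1 * (c * (a * b)).
  rewrite coefCM /F [Poly _ * (_ * _)]mulrCA coefCM [Poly _ * (_ + _)]mulrDr.
  rewrite coefD [Poly _ * (f * _)]mulrA coefMX [(_ * b%:P)`_ _]coefMC.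
  rewrite !mulrDr -mulrA.
  rewrite -[LHS](addrK (c * (a * ((Poly (c :: s))`_i.+1 * b)))).
  by congr (_ - _); rewrite [a * (_ * _)]mulrCA [LHS]mulrCA.
by apply: TB; apply: TM.
Qed.

Lemma base_ring_sum n (u : 'I_n -> K) : (forall i, A (u i)) -> A (\sum_i u i).
Proof.
move=> uA; apply: (big_ind A) => //; first exact: base_ring0.
move=> x y Ax Ay; rewrite -[y]opprK -[- y]sub0r.
by apply: base_ringB => //; apply: base_ringB => //; exact: base_ring0.
Qed.

Lemma ideal_inv_span s x :
  ideal_inv (D_span s) x <-> forall i, A (x * s`_i).
Proof.
split=> [sx i|sx y [a ->]].
  have [ltis|leis] := ltnP i (size s); last first.
    by rewrite nth_default // mulr0; exact: base_ring0.
  apply: sx; exists (fun j => (j == Ordinal ltis)%:R).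
  rewrite (bigD1 (Ordinal ltis)) //= eqxx tofrac1 mul1r big1 ?addr0 //.
  by move=> j /negbTE ->; rewrite tofrac0 mul0r.
rewrite mulr_sumr; apply: base_ring_sum => j.
by rewrite mulrCA; apply: base_ringM => //; exists (a j).
Qed.

Lemma ideal_inv_base : ideal_inv A = A.
Proof.
apply/seteqP; split=> [x /(_ 1 base_ring1)|x Ax y Ay]; first by rewrite mulr1.
exact: base_ringM.
Qed.

Lemma v_closure_base s : v_closure (D_span s) = A <-> ideal_inv (D_span s) = A.
Proof.
rewrite /v_closure; split=> [vA|->]; last exact: ideal_inv_base.
apply/seteqP; split=> [x xs|x Ax y ys].
  by rewrite -ideal_inv_base -vA => y ysi; rewrite mulrC; apply: ysi.
suff : ideal_inv (ideal_inv (D_span s)) y.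
  by rewrite vA => Ay; apply: base_ringM.
by move=> z zs; rewrite mulrC; apply: zs.
Qed.

Local Notation emb := (map_poly (@FracField.tofrac D)).

Lemma emb_base (h : {poly D}) i : A (emb h)`_i.
Proof. by rewrite coef_map; exists h`_i. Qed.

Lemma NvP (h : {poly D}) : @Nv_set D h <->
  h != 0 /\ forall x, (forall i, A (x * (emb h)`_i)) -> A x.
Proof.
rewrite /Nv_set /= v_closure_base /content; split=> -[h0 hA]; split=> //.
  by move=> x /ideal_inv_span; rewrite hA.
apply/seteqP; split=> x; first by move/ideal_inv_span; exact: hA.
move=> Ax; apply/ideal_inv_span => i.
by apply: base_ringM => //; exact: emb_base.
Qed.

Lemma Nv_set1 : @Nv_set D 1.
Proof.
apply/NvP; split; first exact: oner_neq0.
by move=> x /(_ 0%N); rewrite rmorph1 coef1 mulr1.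
Qed.

Lemma Nv_setM (g h : {poly D}) : @Nv_set D g -> @Nv_set D h -> @Nv_set D (g * h).
Proof.
move=> /NvP[g0 gA] /NvP[h0 hA]; apply/NvP; split; first by rewrite mulf_neq0.
have Am : is_submod A.
  split; [exact: base_ring0|exact: base_ringB|by move=> *; exact: base_ringM].
move=> x ghx; apply: hA => i; rewrite -coefCM.
have sA : forall c, c \in (emb g : seq K) -> A c.
  by move=> c /(nthP 0)[j _ <-]; exact: emb_base.
have : sat (emb g) A (x%:P * emb h)`_i.
  apply: sat_poly => // j; rewrite polyseqK mulrCA coefCM -rmorphM; exact: ghx.
elim=> // y _ IH; apply: gA => j.
have [ltj|lej] := ltnP j (size (emb g)).
  by rewrite mulrC; apply: IH; rewrite mem_nth.
by rewrite nth_default // mulr0; exact: base_ring0.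
Qed.

Lemma Nv_set0 : ~ @Nv_set D 0.
Proof. by move/NvP=> []; rewrite eqxx. Qed.

Definition Nv : multSubset {poly D} := MultSubset Nv_set1 Nv_setM Nv_set0.

End NvMultiplicative.

(* Main.v *)
(** A maximal [t]-ideal [M] of [D[X]] is either an upper to zero or [P[X]] with
    [P] a maximal [t]-ideal of [D]: if [0 != d] is in [M] and [h] in [M] lies in
    [N_v], then [(d, h)_v = D[X]], so [M] avoids [N_v]; and a nonzero ideal
    avoiding [N_v] lies in some [P[X]], as finitely many of its coefficients
    always are coefficients of one of its elements.  By the same fact, the
    nonzero maximal ideals of [D[X]_{N_v}] are the extensions of the [P[X]].
    Distinct uppers to zero are incomparable, so a common nonzero prime of two
    maximal [t]-ideals of [D[X]] either is an upper to zero, both containing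
    ideals then being of the form [P[X]], or it contracts to a nonzero prime
    of [D].  As to finite character, an upper to zero is the contraction of a
    principal ideal [f K[X]], and a nonzero polynomial has finitely many
    irreducible factors over [K]. *)

Require Import Defs.
From mathcomp Require Import all_boot all_order all_algebra generic_quotient.
From mathcomp Require Import boolp classical_sets cardinality.

Set Implicit Arguments.
Unset Strict Implicit.
Unset Printing Implicit Defensive.

Import GRing.Theory.

Local Open Scope ring_scope.
Local Open Scope classical_set_scope.

(** * Fractions and divisibility in a domain *)

Lemma fractionP (R : idomainType) (x : {fraction R}) :
  exists a b : R, b != 0 /\ x = a%:F / b%:F.
Proof.
elim/quotW: x => r.
exists (frac r).1, (frac r).2; split; first exact: denom_ratioP.
have d0 := denom_ratioP r.
(* Exposing multiplication and inversion lets [piE] compute on representatives. *)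
rewrite -[RHS]/(FracField.mul _ (FracField.inv _)) !piE.
rewrite /FracField.mulf /FracField.invf !numden_Ratio ?oner_eq0 //.
by rewrite mulr1 mul1r Ratio_numden.
Qed.

Definition divides (R : idomainType) (b x : R) : Prop := exists c, x = b * c.

Section Divides.
Variable R : idomainType.
Implicit Types a b c x y : R.

(** Clearing the denominator lets v-closures be computed without leaving the domain. *)
Lemma base_ring_div a b x : b != 0 ->
  base_ring (a%:F / b%:F * x%:F) <-> divides b (a * x).
Proof.
move=> b0; have F0 : b%:F != 0 by rewrite tofrac_eq0.
rewrite mulrAC -tofracM; split=> [[c _ cE]|[c ->]].
  exists c; apply/eqP; rewrite -tofrac_eq (tofracM b) cE [b%:F * _]mulrC divfK //.
by exists c => //; rewrite tofracM mulrC mulKf.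
Qed.

Lemma divides_mul b x y : divides b x -> divides b (y * x).
Proof. by move=> [c ->]; exists (y * c); rewrite mulrCA. Qed.

Lemma divides_lin b c x y : divides b x -> divides b y -> divides b (c * x + y).
Proof.
by move=> [d ->] [e ->]; exists (c * d + e); rewrite mulrDr mulrCA.
Qed.

Lemma dividesP (p : {poly R}) b :
  divides b%:P p <-> forall i, divides b p`_i.
Proof.
split=> [[q ->] i|bp]; first by exists q`_i; rewrite coefCM.
have [q qE] := choice bp.
exists (\poly_(i < size p) q i); apply/polyP=> i.
rewrite coefCM coef_poly; case: ltnP => // lei.
by rewrite nth_default // mulr0.
Qed.

End Divides.

(** * Proper and prime ideals as sets *)

Section ProperIdeal.
Variable R : idomainType.
Implicit Types (I P : set R) (x y : R).

Lemma proper_idealP I : is_proper_ideal I <->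
  [/\ I 0, ~ I 1 & forall a u v, I u -> I v -> I (a * u + v)].
Proof.
split=> [] [I0 I1 IM]; split.
- by rewrite in_setE in I0.
- by move=> I1'; move/negP: I1; apply; rewrite in_setE.
- by move=> a u v Iu Iv; rewrite -in_setE; apply: IM; rewrite in_setE.
- by rewrite in_setE.
- by apply/negP; rewrite in_setE.
- by move=> a u v; rewrite !in_setE; apply: IM.
Qed.

Lemma ideal0 I : is_proper_ideal I -> I 0.
Proof. by move/proper_idealP=> []. Qed.

Lemma ideal1 I : is_proper_ideal I -> ~ I 1.
Proof. by move/proper_idealP=> []. Qed.

Lemma idealM I a x : is_proper_ideal I -> I x -> I (a * x).
Proof.
move=> /proper_idealP[I0 _ IM] Ix; rewrite -[_ * _]addr0; exact: IM.
Qed.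

Lemma idealD I x y : is_proper_ideal I -> I x -> I y -> I (x + y).
Proof. by move=> /proper_idealP[_ _ IM] Ix Iy; rewrite -[x]mul1r; exact: IM. Qed.

Lemma prime_idealP P : is_prime_ideal P <->
  is_proper_ideal P /\ forall u v, P (u * v) -> P u \/ P v.
Proof.
split=> [] [Pi PM]; split=> // u v.
  move=> Puv; have := PM u v; rewrite in_setE => /(_ Puv)/orP.
  by rewrite !in_setE.
by rewrite in_setE => /PM[] ?; apply/orP; rewrite !in_setE; [left|right].
Qed.

Lemma prime_mul P x y : is_prime_ideal P -> ~ P x -> P (x * y) -> P y.
Proof. by move=> /prime_idealP[_ PM] nx /PM[]. Qed.

End ProperIdeal.

(* [in_v s x] says that [x] lies in [(s)_v]: every [a / b] in [(s)^-1]
   satisfies [(a / b) x \in R]. *)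
Definition in_v (R : idomainType) (s : seq R) (x : R) : Prop :=
  forall a b : R, b != 0 -> (forall c : R, c \in s -> divides b (a * c)) ->
    divides b (a * x).

(** * The t-operation and maximal t-ideals *)

Section TIdeals.
Variable R : idomainType.
Implicit Types (I M N P B : set R) (s t : seq R) (x y z : R).

Lemma in_v_mem s x : x \in s -> in_v s x.
Proof. by move=> xs a b b0; apply. Qed.

Lemma in_v_sub s t x : {subset s <= t} -> in_v s x -> in_v t x.
Proof. by move=> st sx a b b0 bt; apply: sx => // c /st; apply: bt. Qed.

Lemma in_v_trans s t x :
  (forall c, c \in t -> in_v s c) -> in_v t x -> in_v s x.
Proof. by move=> st tx a b b0 bs; apply: tx => // c /st; apply. Qed.

Lemma in_v_scale y s x : in_v s x -> in_v [seq y * c | c <- s] (y * x).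
Proof.
move=> sx a b b0 bs; rewrite mulrA; apply: sx => // c cs.
by rewrite -mulrA; apply: bs; apply: map_f.
Qed.

Lemma in_v_lin x u v : in_v [:: u; v] (x * u + v).
Proof.
move=> a b b0 bs; rewrite mulrDr mulrCA.
by apply: divides_lin; apply: bs; rewrite !inE eqxx ?orbT.
Qed.

(** Every element of the quotient field has the form [a / b], so the tests in [in_v] exhaust the
    inverse ideal. *)
Lemma in_vP s x : in_v s x <->
  v_closure (D_span [seq c%:F | c <- s]) x%:F.
Proof.
split=> [sx y ys|sx a b b0 bs].
  have [a [b [b0 yE]]] := fractionP y.
  rewrite yE mulrC; apply/base_ring_div => //; apply: sx => // c cs.
  apply/base_ring_div => //; rewrite -yE.
  have /ideal_inv_span/(_ (index c s)) := ys.
  by rewrite (nth_map 0) ?index_mem // nth_index.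
apply/base_ring_div => //; rewrite mulrC; apply: sx.
apply/ideal_inv_span => i; have [lti|lei] := ltnP i (size s).
  by rewrite (nth_map 0) //; apply/base_ring_div => //; apply: bs; rewrite mem_nth.
by rewrite nth_default ?size_map // mulr0; exact: base_ring0.
Qed.

Lemma D_span_nth (s : seq {fraction R}) i : D_span s s`_i.
Proof.
have [lti|lei] := ltnP i (size s); last first.
  rewrite nth_default //; exists (fun=> 0).
  by rewrite big1 // => j _; rewrite tofrac0 mul0r.
exists (fun j => (j == Ordinal lti)%:R).
rewrite (bigD1 (Ordinal lti)) //= eqxx tofrac1 mul1r big1 ?addr0 //.
by move=> j /negbTE ->; rewrite tofrac0 mul0r.
Qed.

Lemma D_span_ideal I s : is_proper_ideal I -> (forall c, c \in s -> I c) ->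
  D_span [seq c%:F | c <- s] `<=` [set x%:F | x in I].
Proof.
move=> Ii sI _ [a ->].
elim/big_ind: _ => [|_ _ [x Ix <-] [y Iy <-]|i _].
- by exists 0; [exact: ideal0|exact: tofrac0].
- by exists (x + y); [exact: idealD|exact: tofracD].
exists (a i * s`_i); last by rewrite tofracM (nth_map 0) // -(size_map (@FracField.tofrac R) s).
by apply: idealM => //; apply: sI; rewrite mem_nth // -(size_map (@FracField.tofrac R) s).
Qed.

Lemma t_idealP I : is_proper_t_ideal I <->
  [/\ is_proper_ideal I, nonzero_ideal I &
      forall s x, (forall c, c \in s -> I c) -> in_v s x -> I x].
Proof.
split=> [[Ii [i Iy i0] tI]|[Ii [i Iy i0] tI]]; split=> //; try by exists i.
  move=> s x sI sx.
  suff : [set x%:F | x in I] x%:F.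
    by move=> [y Iy' /eqP]; rewrite tofrac_eq => /eqP <-.
  (* Prepending the nonzero [i] makes the span nonzero, as [t_closure] demands, even when [s] is
     empty. *)
  rewrite -tI; exists [seq c%:F | c <- i :: s]; split.
  - by apply: D_span_ideal => // c; rewrite inE => /predU1P[->|/sI].
  - move=> s0; have := D_span_nth [seq c%:F | c <- i :: s] 0%N.
    by rewrite s0 /= => /eqP; rewrite tofrac_eq0 (negbTE i0).
  - apply/in_vP; apply: in_v_sub sx => c cs; rewrite inE cs orbT //.
apply/seteqP; split=> [x [s [sI _ sx]]|_ [x Ix <-]].
  have /choice[f fE] : forall j, exists y, I y /\ s`_j = y%:F.
    by move=> j; have [y Iy' <-] := sI _ (D_span_nth s j); exists y.
  have sE : s = [seq c%:F | c <- mkseq f (size s)].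
    apply: (@eq_from_nth _ 0); first by rewrite !size_map size_iota.
    by move=> j ltj; rewrite -map_comp (nth_map 0%N) ?size_iota // nth_iota // (fE _).2.
  (* The inverse of an integral ideal contains 1, so the v-closure stays in the base ring. *)
  have [y _ yE] : base_ring x.
    rewrite -[x]mulr1; apply: sx; apply/ideal_inv_span => j.
    by rewrite mul1r (fE j).2; exists (f j).
  rewrite -yE; exists y => //; apply: (tI (mkseq f (size s))).
    by move=> c /mapP[j _ ->]; exact: (fE j).1.
  by apply/in_vP; rewrite -sE yE.
exists [seq c%:F | c <- [:: i; x]]; split.
- by apply: D_span_ideal => // c; rewrite !inE => /orP[] /eqP ->.
- move=> s0; have := D_span_nth [seq c%:F | c <- [:: i; x]] 0%N.
  by rewrite s0 /= => /eqP; rewrite tofrac_eq0 (negbTE i0).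
by apply/in_vP; apply: in_v_mem; rewrite !inE eqxx orbT.
Qed.

Lemma tMax_max M N : tMax M -> is_proper_t_ideal N -> M `<=` N -> N = M.
Proof. by move=> [_]; apply. Qed.

Lemma tMax_ideal M : tMax M -> is_proper_ideal M.
Proof. by move=> [/t_idealP[]]. Qed.

Lemma tMax_in_v M s x : tMax M -> (forall c, c \in s -> M c) -> in_v s x -> M x.
Proof. by move=> [/t_idealP[_ _ +] _]; apply. Qed.

(** For [B] with a nonzero element, this is the t-closure of the ideal generated by [B]; [B] itself
    may be any subset. *)
Definition t_hull B : set R :=
  [set x | exists2 s, (forall c, c \in s -> B c) & in_v s x].

Lemma sub_t_hull B : B `<=` t_hull B.
Proof.
move=> x Bx; exists [:: x]; last by apply: in_v_mem; rewrite inE.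
by move=> c; rewrite inE => /eqP ->.
Qed.

(** Idempotence of the hull: each entry of [s] draws on finitely many elements of [B], and the
    concatenation of these lists serves all entries at once. *)
Lemma t_hull_in_v B s x : (forall c, c \in s -> t_hull B c) -> in_v s x ->
  t_hull B x.
Proof.
move=> sB sx.
suff [t tB ts] : exists2 t, (forall c, c \in t -> B c) &
    forall c, c \in s -> in_v t c.
  by exists t => //; apply: in_v_trans sx.
elim: s sB {sx} => [|y s IHs] sB; first by exists [::].
have [c cs|t tB ts] := IHs; first by apply: sB; rewrite inE cs orbT.
have [u uB uy] := sB y (mem_head _ _).
exists (u ++ t) => [c|c]; first by rewrite mem_cat => /orP[/uB|/tB].
rewrite inE => /predU1P[->|ct]; [apply: in_v_sub uy|apply: in_v_sub (ts _ ct)];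
  by move=> d dx; rewrite mem_cat dx ?orbT.
Qed.

Lemma t_hull_ideal B x : B x -> x != 0 -> ~ t_hull B 1 ->
  is_proper_t_ideal (t_hull B).
Proof.
move=> Bx x0 B1; apply/t_idealP; split; last exact: t_hull_in_v.
  apply/proper_idealP; split=> // [|a u v Bu Bv].
    by apply: (@t_hull_in_v B [:: x]); [move=> c; rewrite inE => /eqP ->;
      exact: sub_t_hull|move=> a b b0 _; rewrite mulr0; exists 0; rewrite mulr0].
  apply: (t_hull_in_v _ (@in_v_lin a u v)) => c.
  by rewrite !inE => /orP[] /eqP ->.
by exists x => //; exact: sub_t_hull.
Qed.

(** Zorn's lemma is applied to arbitrary sets [S] such that the hull of [S] united with [B] misses
    1. A failure is witnessed by a finite list, which already lies in one member of a chain united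
    with [B]; keeping [B] apart settles the empty chain. *)
Lemma exists_tMax B x : B x -> x != 0 -> ~ t_hull B 1 ->
  exists2 M, tMax M & B `<=` M.
Proof.
move=> Bx x0 B1; pose avoids1 (S : set R) := ~ t_hull (S `|` B) 1.
have [F Fa Ft|M [Ma Mmax]] := @Zorn_bigcup _ avoids1.
  move=> [s sF s1].
  have [[S FS sS]|sB] : (exists2 S, F S & forall c, c \in s -> (S `|` B) c) \/
      (forall c, c \in s -> B c).
  - elim: s sF {s1} => [|y s IHs] sF; first by right.
    have [c cs|[S FS sS]|sB] := IHs; first by apply: sF; rewrite inE cs orbT.
    + have [[T FT Ty]|By] := sF y (mem_head _ _); left.
        have [ST|TS] := Ft _ _ FS FT.
          exists T => // c; rewrite inE => /predU1P[->|/sS [/ST|]]; by [left|right].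
        exists S => // c; rewrite inE => /predU1P[->|/sS //].
        by left; apply: TS.
      by exists S => // c; rewrite inE => /predU1P[->|/sS //]; right.
    + have [[T FT Ty]|By] := sF y (mem_head _ _).
        left; exists T => // c; rewrite inE => /predU1P[->|/sB]; by [left|right].
      by right=> c; rewrite inE => /predU1P[->|/sB].
  - by apply: (Fa _ FS); exists s.
  - by apply: B1; exists s.
(* Maximality of [M] is used twice in this form: for its own hull, which makes [M] a t-ideal, and
   for the t-ideals above it. *)
have avoids_sup N : M `|` B `<=` N ->
    (forall s y, (forall c, c \in s -> N c) -> in_v s y -> N y) -> ~ N 1 -> N = M.
  move=> MN Nt N1; apply: contrapT => neq.
  apply: (Mmax N); last first.
    move=> [s sN s1]; apply: N1; apply: Nt s1 => c /sN[//|Bc].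
    by apply: MN; right.
  split=> [y My|NM]; first by apply: MN; left.
  by apply: neq; apply/seteqP; split=> // y My; apply: MN; left.
have hullE : t_hull (M `|` B) = M.
  by apply: avoids_sup; [exact: sub_t_hull|exact: t_hull_in_v|exact: Ma].
have MBt : is_proper_t_ideal M.
  by rewrite -hullE; apply: (t_hull_ideal (x := x)) => //; right.
have BM : B `<=` M by move=> y By; rewrite -hullE; apply: sub_t_hull; right.
exists M => //; split=> // N /t_idealP[Ni _ Nt] MN; apply: avoids_sup => //.
- by move=> y [/MN|/BM/MN].
- exact: ideal1.
Qed.

(** If [x] is not in [M], then 1 is in the v-closure of a list from [M] and [x]. Multiplied by [y],
    the list falls into [M] because [x * y] does, so [y] is in [M]. *)
Lemma tMax_prime M : tMax M -> is_prime_ideal M.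
Proof.
move=> tM; apply/prime_idealP; split=> [|x y Mxy]; first exact: tMax_ideal.
have [Mx|nMx] := pselect (M x); [by left|right].
have [/t_idealP[Mi [m Mm m0] Mt] _] := tM.
suff [s sM s1] : t_hull (M `|` [set x]) 1.
  have := @in_v_scale y _ _ s1; rewrite mulr1; apply: Mt => _ /mapP[c /sM [Mc|->] ->].
    exact: idealM.
  by rewrite mulrC.
apply: contrapT => n1.
have [|N tN MN] := exists_tMax (B := M `|` [set x]) (x := m) _ m0 n1; first by left.
apply: nMx; rewrite -(tMax_max tM tN.1); first by apply: MN; right.
by move=> z Mz; apply: MN; left.
Qed.

End TIdeals.

(** * Extension and contraction between [D] and [D[X]] *)

Section PolyTMax.
Variable D : idomainType.
Implicit Types (f g h : {poly D}) (P : set D) (I M N Q W : set {poly D}).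

Definition poly_ext P : set {poly D} := [set f | forall i, P f`_i].

Definition contraction I : set D := [set c | I c%:P].

Lemma poly_extK P : P 0 -> contraction (poly_ext P) = P.
Proof.
move=> P0; apply/seteqP; split=> c; first by move=> /(_ 0%N); rewrite coefC eqxx.
by move=> Pc i; rewrite coefC; case: eqP.
Qed.

Lemma Nv_in_v h : Nv_set h <-> h != 0 /\ in_v h 1.
Proof.
rewrite NvP; split=> -[h0 hA]; split=> //.
  move=> a b b0 bh; rewrite -(base_ring_div _ _ b0) tofrac1 mulr1; apply: hA => i.
  rewrite coef_map /= base_ring_div //; have [lti|lei] := ltnP i (size h).
    by apply: bh; rewrite mem_nth.
  by rewrite nth_default // mulr0; exists 0; rewrite mulr0.
move=> x; have [a [b [b0 ->]]] := fractionP x.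
move=> hx; rewrite -[_ / _]mulr1 -tofrac1 base_ring_div //; apply: hA => // c.
move=> /(nthP 0)[i _ <-]; rewrite -base_ring_div //.
by have := hx i; rewrite coef_map.
Qed.

(* [sat_poly] plays the role of the Dedekind-Mertens lemma here. *)
Lemma Nv_div h (u : {poly D}) (d : D) : Nv_set h -> d != 0 ->
  divides d%:P (u * h) -> divides d%:P u.
Proof.
move=> /NvP[h0 hA] d0 duh; apply/dividesP => i; rewrite -[u`_i]mul1r.
rewrite -base_ring_div // tofrac1.
pose emb := map_poly (@FracField.tofrac D).
have Am : is_submod (@base_ring D).
  split; [exact: base_ring0|exact: base_ringB|by move=> *; exact: base_ringM].
have sA : forall c, c \in (emb h : seq _) -> base_ring c.
  by move=> c /(nthP 0)[j _ <-]; exact: emb_base.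
have : sat (emb h) (@base_ring D) ((1 / d%:F)%:P * emb u)`_i.
  apply: sat_poly => // j; rewrite polyseqK mulrCA coefCM -rmorphM.
  rewrite /emb coef_map /= mulrC -tofrac1 mulrC base_ring_div // mul1r mulrC.
  by move/dividesP: duh.
(* The induction removes one power of the content at a time: if all multiples of [y] by coefficients
   of [h] are in [D], so is [y]. *)
rewrite coefCM coef_map /=; elim=> // y _ IH; apply: hA => j.
have [ltj|lej] := ltnP j (size (emb h)).
  by rewrite mulrC; apply: IH; rewrite mem_nth.
by rewrite nth_default // mulr0; exact: base_ring0.
Qed.

(** Let [a / b] carry [d] to [u] and [h] to [w]. Then [u * h = d * w], so [Nv_div] gives
    [u = d * v], and [a / b] is the polynomial [v]. *)
Lemma in_v_const_Nv (d : D) h : d != 0 -> Nv_set h -> in_v [:: d%:P; h] 1.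
Proof.
move=> d0 hN a b b0 bs; rewrite mulr1.
have [u uE] : divides b (a * d%:P) by apply: bs; rewrite !inE eqxx.
have [w wE] : divides b (a * h) by apply: bs; rewrite !inE eqxx orbT.
have dP0 : d%:P != 0 by rewrite polyC_eq0.
have [|v vE] := Nv_div (u := u) hN d0.
  exists w; apply: (mulfI b0).
  rewrite [LHS]mulrA -uE mulrAC wE -mulrA; congr (_ * _).
  exact: mulrC.
exists v; apply: (mulIf dP0); rewrite uE vE -mulrA; congr (_ * _).
exact: mulrC.
Qed.

(* Finitely many coefficients of elements of [I] are coefficients of a single
   element, obtained by adding up shifts by powers of ['X]. *)
Lemma common_content I (s : seq D) : is_proper_ideal I ->
  (forall c, c \in s -> exists2 f, I f & exists i, c = f`_i) ->
  exists2 f, I f & forall c, c \in s -> exists i, c = f`_i.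
Proof.
move=> Ii; elim: s => [|c s IHs] sI; first by exists 0; first exact: ideal0.
have [d ds|f If fs] := IHs; first by apply: sI; rewrite inE ds orbT.
have [g Ig [j cE]] := sI c (mem_head _ _).
(* The shift by [size f] keeps the coefficients of [f] and [g] apart. *)
exists (f + 'X^(size f) * g); first by apply: idealD => //; exact: idealM.
move=> d; rewrite inE => /predU1P[->|/fs[i ->]].
  exists (size f + j)%N; rewrite coefD coefXnM nth_default ?leq_addr //.
  by rewrite ltnNge leq_addr /= addKn add0r.
have [lti|lei] := ltnP i (size f).
  by exists i; rewrite coefD coefXnM lti addr0.
(* An index past the end of [f] stands for 0, which must be read off past the end of the whole
   sum. *)
exists (size f + size g)%N; rewrite coefD coefXnM ltnNge leq_addr /= addKn.
by rewrite !nth_default ?leq_addr // addr0.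
Qed.

Lemma sub_poly_ext I : is_proper_ideal I -> nonzero_ideal I ->
  (forall f, I f -> ~ Nv_set f) -> exists2 P, tMax P & I `<=` poly_ext P.
Proof.
move=> Ii [g Ig g0] INv.
pose B : set D := [set c | exists2 f, I f & exists i, c = f`_i].
have Bg : B (lead_coef g) by exists g => //; exists (size g).-1.
have lg0 : lead_coef g != 0 by rewrite lead_coef_eq0.
suff B1 : ~ t_hull B 1.
  have [P tP BP] := exists_tMax Bg lg0 B1.
  by exists P => // f If i; apply: BP; exists f => //; exists i.
move=> [s sB s1].
(* The nonzero [lead_coef g] joins the list so that the common [f] is nonzero, as [Nv_set]
   requires. *)
have [c|f If fs] := common_content (s := lead_coef g :: s) Ii.
  by rewrite inE => /predU1P[->|/sB].
apply: (INv f If); apply/Nv_in_v; split.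
  apply/eqP => f0; have [i] := fs _ (mem_head _ _).
  by rewrite f0 coef0 => /eqP; rewrite (negbTE lg0).
apply: in_v_trans s1 => c cs a b b0 bf.
have [|i ->] := fs c; first by rewrite inE cs orbT.
have [lti|lei] := ltnP i (size f); first by apply: bf; rewrite mem_nth.
by rewrite nth_default // mulr0; exists 0; rewrite mulr0.
Qed.

Lemma poly_ext_Nv P f : tMax P -> poly_ext P f -> ~ Nv_set f.
Proof.
move=> tP Pf /Nv_in_v[_ f1]; apply: (ideal1 (tMax_ideal tP)).
by apply: tMax_in_v f1 => // c /(nthP 0)[i _ <-].
Qed.

Lemma poly_ext_ideal P : is_proper_ideal P -> is_proper_ideal (poly_ext P).
Proof.
move=> Pi; apply/proper_idealP; split.
- by move=> i; rewrite coef0; exact: ideal0.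
- by move=> /(_ 0%N); rewrite coef1; exact: ideal1.
move=> a u v Pu Pv i; rewrite coefD coefM; apply: idealD => //.
by elim/big_ind: _ => [|x y|j _]; [exact: ideal0|exact: idealD|exact: idealM].
Qed.

(** Take the first coefficients [u_i] and [v_j] outside [P]: modulo [P], the coefficient of index
    [i + j] in [u * v] is [u_i v_j]. *)
Lemma prime_poly_ext P : is_prime_ideal P -> is_prime_ideal (poly_ext P).
Proof.
move=> pP; have [Pi PM] := pP; apply/prime_idealP; split.
  exact: poly_ext_ideal.
move=> u v Puv; have [|nPu] := pselect (poly_ext P u); first by left.
have [|nPv] := pselect (poly_ext P v); first by right.
exfalso.
have first_notin f : ~ poly_ext P f ->
    exists2 i, ~ P f`_i & forall j, (j < i)%N -> P f`_j.
  move=> /existsNP[n Pn].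
  have ex : exists n, `[< ~ P f`_n >] by exists n; apply/asboolP.
  have [i /asboolP Pi' imin] := ex_minnP ex; exists i => // j ltji.
  apply: contrapT => /asboolP/imin; by rewrite leqNgt ltji.
have [i Pi' imin] := first_notin u nPu; have [j Pj jmin] := first_notin v nPv.
apply: (Pj); apply: (prime_mul pP Pi').
have lti : (i < (i + j).+1)%N by rewrite ltnS leq_addr.
have := Puv (i + j)%N; rewrite coefM (bigD1 (Ordinal lti)) //= addKn => Ps.
rewrite -[_ * _](addrK (\sum_(k < (i + j).+1 | k != Ordinal lti)
  u`_k * v`_(i + j - k))) -mulN1r.
apply: idealD => //; apply: idealM => //.
elim/big_ind: _ => [|x y|k]; [exact: ideal0|exact: idealD|move=> ki].
have [ltki|ltik|eqki] := ltngtP k i.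
- by rewrite mulrC; apply: idealM => //; apply: imin.
- apply: idealM => //; apply: jmin.
  by rewrite ltn_subLR ?ltn_add2r // -ltnS.
- by case/eqP: ki; apply: val_inj.
Qed.

Lemma contraction_prime W : is_prime_ideal W -> is_prime_ideal (contraction W).
Proof.
move=> /prime_idealP[Wi WM]; apply/prime_idealP; split.
  apply/proper_idealP; split; rewrite /contraction /=.
  - by rewrite polyC0; exact: ideal0.
  - by rewrite polyC1; exact: ideal1.
  - by move=> a u v Wu Wv; rewrite polyCD polyCM; apply: idealD => //; exact: idealM.
by move=> u v; rewrite /contraction /= polyCM => /WM.
Qed.

(** Testing with constant fractions suffices: if [a / b] carries all coefficients of the list into
    [D], it carries the list, hence [g], into [D[X]]. *)
Lemma poly_ext_t_ideal P : tMax P -> is_proper_t_ideal (poly_ext P).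
Proof.
move=> tP; have [/t_idealP[Pi [d Pd d0] Pt] _] := tP.
apply/t_idealP; split; first exact: poly_ext_ideal.
  by exists d%:P; rewrite ?polyC_eq0 // => i; rewrite coefC; case: eqP => // _; exact: ideal0.
move=> s g sP sg i; apply: (Pt (flatten [seq (f : seq D) | f <- s])).
  by move=> c /flatten_mapP[f /sP Pf /(nthP 0)[j _ <-]].
move=> a b b0 bs; have /dividesP/(_ i) : divides b%:P (a%:P * g).
  apply: sg => [|f fs]; first by rewrite polyC_eq0.
  apply/dividesP => j; rewrite coefCM; have [ltj|lej] := ltnP j (size f).
    by apply: bs; apply/flatten_mapP; exists f => //; rewrite mem_nth.
  by rewrite nth_default // mulr0; exists 0; rewrite mulr0.
by rewrite coefCM.
Qed.

(** A t-ideal [N] above [P[X]] contains a nonzero constant, so it avoids [N_v] and lies in some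
    [P'[X]]. Contracting to [D] puts [P] inside [P'], and maximality of [P] gives equality. *)
Lemma tMax_poly_ext P : tMax P -> tMax (poly_ext P).
Proof.
move=> tP; split=> [|N tN PN]; first exact: poly_ext_t_ideal.
have [Ni N0 Nt] := (t_idealP N).1 tN.
have [/t_idealP[Pi [d Pd d0] _] _] := tP.
have Nd : N d%:P.
  by apply: PN => i; rewrite coefC; case: eqP => // _; exact: ideal0.
have [f Nf fNv|P' tP' NP'] := sub_poly_ext Ni N0.
  apply: (ideal1 Ni); apply: Nt (in_v_const_Nv d0 fNv) => c.
  by rewrite !inE => /orP[] /eqP ->.
suff PP' : P' = P by apply/seteqP; split=> //; rewrite -PP'.
apply: (tMax_max tP tP'.1).
rewrite -(poly_extK (ideal0 Pi)) -(poly_extK (ideal0 (tMax_ideal tP'))).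
by move=> c Pc; apply/NP'/PN.
Qed.

Lemma tMax_poly_cases M : tMax M ->
  (forall a : D, M a%:P -> a = 0) \/ exists2 P, tMax P & M = poly_ext P.
Proof.
move=> tM; have [|/existsNP[d /not_implyP[Md /eqP d0]]] :=
  pselect (forall a : D, M a%:P -> a = 0); first by left.
right; have [/t_idealP[Mi M0 Mt] _] := tM.
have [f Mf fNv|P tP MP] := sub_poly_ext Mi M0.
  apply: (ideal1 Mi); apply: Mt (in_v_const_Nv d0 fNv) => c.
  by rewrite !inE => /orP[] /eqP ->.
by exists P => //; apply/esym/(tMax_max tM _ MP)/poly_ext_t_ideal.
Qed.

(** * Uppers to zero *)

(* [f] generates the extension of [Q] to [K[X]], [K] the quotient field. *)
Lemma upper_generator Q : is_upper_to_zero Q ->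
  exists f, [/\ Q f, f != 0, (1 < size f)%N & forall g, Q g ->
    exists d q, d != 0 /\ d%:P * g = q * f].
Proof.
move=> [pQ [f1 Qf1 f10] Q0]; have Qi := pQ.1.
(* The generator is a nonzero element of [Q] of least size. *)
have ex : exists n, `[< exists2 f, Q f & f != 0 /\ size f = n >].
  by exists (size f1); apply/asboolP; exists f1.
have [n /asboolP[f Qf [f0 sf]] nmin] := ex_minnP ex.
exists f; split=> //.
  rewrite ltnNge; apply/negP => /size1_polyC fE; case/eqP: f0.
  by rewrite fE (Q0 f`_0) // -fE.
(* Pseudo-division replaces division over the quotient field; a nonzero remainder would be a smaller
   element of [Q]. *)
move=> g Qg; have [k [q [r [fg rs]]]] : exists k q r,
    lead_coef f ^+ k *: g = q * f + r /\ (size r < size f)%N.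
  exists (scalp g f), (g %/ f)%R, (g %% f)%R.
  by rewrite Pdiv.Idomain.divp_eq ltn_modp.
exists (lead_coef f ^+ k), q; split; first by rewrite expf_neq0 ?lead_coef_eq0.
suff r0 : r = 0 by rewrite mul_polyC fg r0 addr0.
apply/eqP; apply: contraT => r0.
have /asboolP/nmin : exists2 f, Q f & f != 0 /\ size f = size r.
  exists r => //; have -> : r = (- q) * f + lead_coef f ^+ k *: g.
    by rewrite fg mulNr addKr.
  by rewrite -mul_polyC; apply: idealD => //; exact: idealM.
by rewrite leqNgt -sf rs.
Qed.

Lemma upper_mul Q (d : D) g : is_upper_to_zero Q -> d != 0 -> Q (d%:P * g) -> Q g.
Proof.
by move=> [pQ _ Q0] d0; apply: prime_mul => // /Q0 dE; rewrite dE eqxx in d0.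
Qed.

Lemma upper_sub Q W f : is_upper_to_zero W -> W f ->
  (forall g, Q g -> exists d q, d != 0 /\ d%:P * g = q * f) -> Q `<=` W.
Proof.
move=> uW Wf fQ g /fQ[d [q [d0 E]]]; apply: (upper_mul uW d0).
by rewrite E; apply: idealM => //; case: uW => [[]].
Qed.

(** Let [f] and [w] be the generators of [Q] and [W], with [d w = q f]. If [f] is not in [W], then
    [q] is; but [q] has smaller degree than [w], since [f] is not constant. *)
Lemma upper_minimal Q W : is_upper_to_zero Q -> is_prime_ideal W ->
  nonzero_ideal W -> W `<=` Q -> W = Q.
Proof.
move=> uQ pW W0 WQ; have [pQ _ Q0] := uQ.
have uW : is_upper_to_zero W by split=> // a /WQ/Q0.
have [f [Qf f0 sf fQ]] := upper_generator uQ.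
have [w [Ww w0 _ wW]] := upper_generator uW.
apply/seteqP; split=> //; apply: (upper_sub uW _ fQ).
have [d [q [d0 dw]]] := fQ w (WQ _ Ww).
have Wqf : W (q * f) by rewrite -dw; apply: idealM => //; exact: pW.1.
have [//|nWf] := pselect (W f); exfalso.
have Wq : W q by apply: (prime_mul pW nWf); rewrite mulrC.
have [e [p [e0 eq]]] := wW q Wq.
have q0 : q != 0.
  apply/eqP => q0; move/eqP: dw; rewrite q0 mul0r mulf_eq0 polyC_eq0.
  by rewrite (negbTE d0) (negbTE w0).
have sq : (size q < size w)%N.
  have := congr1 (fun p : {poly D} => size p) dw.
  rewrite /= mul_polyC size_scale // => ->; rewrite size_mul // -subn1 -addnBA.
    by rewrite -[ltnLHS]addn0 ltn_add2l subn_gt0.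
  exact: ltnW.
have p0 : p != 0.
  apply/eqP => p0; move/eqP: eq; rewrite p0 mul0r mulf_eq0 polyC_eq0.
  by rewrite (negbTE e0) (negbTE q0).
have := congr1 (fun p : {poly D} => size p) eq.
rewrite /= mul_polyC size_scale // size_mul // => sE; move: sq; rewrite sE ltnNge.
by rewrite -(prednK (n := size p)) ?size_poly_gt0 // addSn leq_addl.
Qed.

(** A common denominator [d] makes every [d c], for [c] in the list, a multiple of the generator
    [f]. So [d / f] is in the inverse ideal, [d g] is a multiple of [f], and [d] cancels modulo
    [Q]. *)
Lemma upper_t_ideal Q : is_upper_to_zero Q -> is_proper_t_ideal Q.
Proof.
move=> uQ; have [pQ Q0 _] := uQ; have Qi := pQ.1; apply/t_idealP; split=> // s g sQ sg.
have [f [Qf f0 _ fQ]] := upper_generator uQ.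
have [d d0 ds] : exists2 d : D, d != 0 & forall c, c \in s -> divides f (d%:P * c).
  elim: s sQ {sg} => [|c s IHs] sQ; first by exists 1; first exact: oner_neq0.
  have [e es|e e0 es] := IHs; first by apply: sQ; rewrite inE es orbT.
  have [d [q [d0 dE]]] := fQ c (sQ _ (mem_head _ _)).
  exists (e * d); first by rewrite mulf_neq0.
  move=> x; rewrite inE polyCM => /predU1P[->|/es ex].
    by exists (e%:P * q); rewrite -mulrA dE mulrA mulrC.
  by rewrite mulrAC mulrC; exact: divides_mul.
apply: (upper_mul uQ d0).
by have [c ->] := sg _ _ f0 ds; rewrite mulrC; exact: idealM.
Qed.

Lemma exists_tMax_upper Q : is_upper_to_zero Q -> exists2 M, tMax M & Q `<=` M.
Proof.
move=> uQ; have [pQ [f Qf f0] _] := uQ; apply: (exists_tMax Qf f0).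
have /t_idealP[Qi _ Qt] := upper_t_ideal uQ.
by move=> [s sQ s1]; apply: (ideal1 Qi); apply: Qt s1.
Qed.

(** Irreducible factors are peeled off one by one: if [Q] contains [h], write [d h = q f]. Any upper
    containing [h] contains [f], and then equals [Q], or contains [q], of smaller degree. *)
Lemma finite_uppers h : h != 0 ->
  finite_set [set Q | is_upper_to_zero Q /\ Q h].
Proof.
have [n] := ubnP (size h); elim: n h => // n IHn h; rewrite ltnS => sh h0.
have [[Q [uQ Qh]]|nQ] := pselect (exists Q, is_upper_to_zero Q /\ Q h); last first.
  rewrite (_ : [set Q | _] = set0) //; apply/seteqP; split=> // Q HQ.
  by apply: nQ; exists Q.
have [f [Qf f0 sf fQ]] := upper_generator uQ.
have [d [q [d0 dh]]] := fQ h Qh.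
have q0 : q != 0.
  apply/eqP => q0; move/eqP: dh; rewrite q0 mul0r mulf_eq0 polyC_eq0.
  by rewrite (negbTE d0) (negbTE h0).
have sq : (size q < n)%N.
  apply: leq_trans sh.
  have := congr1 (fun p : {poly D} => size p) dh.
  rewrite /= mul_polyC size_scale // => ->; rewrite size_mul // -subn1 -addnBA.
    by rewrite -[ltnLHS]addn0 ltn_add2l subn_gt0.
  exact: ltnW.
apply: (@sub_finite_set _ _ ([set Q] `|` [set W | is_upper_to_zero W /\ W q])).
  move=> W [uW Wh]; have [pW _ _] := uW.
  have [Wf|nWf] := pselect (W f).
    left; apply/esym; have [pQ Qn _] := uQ; apply: upper_minimal => //.
    exact: upper_sub uW Wf fQ.
  right; split=> //; apply: (prime_mul pW nWf); rewrite mulrC -dh.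
  by apply: idealM => //; exact: pW.1.
by rewrite finite_setU; split=> //; apply: IHn.
Qed.

End PolyTMax.

(** * Ideals of a localization *)

Lemma frac_lin (A : comNzRingType) (z u v s t r : A) :
  (z * u + v) * (s * t * r) = z * s * (u * t) * r + v * r * (s * t).
Proof.
rewrite mulrDl !mulrA; congr (_ + _).
  by congr (_ * _ * _); rewrite mulrAC.
by rewrite -!mulrA; congr (_ * _); rewrite mulrA mulrC.
Qed.

Section LocIdeals.
Variables (R : idomainType) (S : multSubset R).
Implicit Types (a s : R) (x : localization S) (I P : set R).
Implicit Types (M W : set (localization S)).

Lemma is_fraction_tofrac a : a%:F \in is_fraction S.
Proof.
apply/asboolP; exists a, 1; split; first exact: mult_set1.
by rewrite tofrac1 divr1.
Qed.

Definition to_loc a : localization S := Sub a%:F (is_fraction_tofrac a).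

Definition loc_contr M : set R := [set a | M (to_loc a)].

Definition loc_ext I : set (localization S) :=
  [set x | exists a s, [/\ I a, mult_set S s & val x = a%:F / s%:F]].

Lemma loc_fraction x : exists a s, mult_set S s /\ x * to_loc s = to_loc a.
Proof.
have /asboolP[a [s [Ss xE]]] := valP x; exists a, s; split=> //.
apply: val_inj; by rewrite rmorphM /= xE divfK ?(mult_set_neq0 Ss).
Qed.

Lemma to_loc_inv s : mult_set S s -> exists y, y * to_loc s = 1.
Proof.
move=> Ss; have s0 := mult_set_neq0 Ss.
have sV : (s%:F)^-1 \in is_fraction S.
  by apply/asboolP; exists 1, s; rewrite tofrac1 mul1r.
exists (Sub (s%:F)^-1 sV : localization S); apply: val_inj.
by rewrite rmorphM rmorph1 /= mulVf.
Qed.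

Lemma to_loc0 : to_loc 0 = 0.
Proof. by apply: val_inj; rewrite rmorph0 /= tofrac0. Qed.

Lemma to_loc1 : to_loc 1 = 1.
Proof. by apply: val_inj; rewrite rmorph1 /= tofrac1. Qed.

Lemma to_locD a b : to_loc (a + b) = to_loc a + to_loc b.
Proof. by apply: val_inj; rewrite rmorphD /= tofracD. Qed.

Lemma to_locM a b : to_loc (a * b) = to_loc a * to_loc b.
Proof. by apply: val_inj; rewrite rmorphM /= tofracM. Qed.

Lemma to_loc_eq0 a : (to_loc a == 0) = (a == 0).
Proof. by rewrite -val_eqE rmorph0 /= tofrac_eq0. Qed.

Lemma loc_num_neq0 x a s : mult_set S s -> x * to_loc s = to_loc a ->
  x != 0 -> a != 0.
Proof.
move=> Ss xE x0; rewrite -(to_loc_eq0 a) -xE.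
apply: mulf_neq0; first exact: x0.
by rewrite to_loc_eq0 -(tofrac_eq0 s); exact: mult_set_neq0 Ss.
Qed.

Lemma loc_contr_frac M x a s : is_proper_ideal M -> mult_set S s ->
  x * to_loc s = to_loc a -> M x <-> loc_contr M a.
Proof.
move=> Mi Ss xE; rewrite /loc_contr /= -xE; split=> [Mx|Mxs].
  by rewrite mulrC; apply: idealM.
have [y yE] := to_loc_inv Ss.
by rewrite -[x]mulr1 -yE mulrCA; apply: idealM.
Qed.

(** Membership does not depend on the fraction chosen: [a / s = b / t] with [b] in [P] puts [a * t]
    in [P], while [t] is outside [P]. *)
Lemma loc_extP P x a s : is_prime_ideal P -> (forall t, P t -> ~ mult_set S t) ->
  mult_set S s -> x * to_loc s = to_loc a -> loc_ext P x <-> P a.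
Proof.
move=> pP PS Ss xE; have s0 := mult_set_neq0 Ss.
have {}xE : val x = a%:F / s%:F.
  by move/(congr1 val): xE; rewrite rmorphM /= => <-; rewrite mulfK.
split=> [[b [t [Pb St]]]|Pa]; last by exists a, s.
have t0 := mult_set_neq0 St.
rewrite xE => /eqP; rewrite eqr_div // -!tofracM tofrac_eq => /eqP E.
apply: (prime_mul (x := t) pP); first by move/PS.
by rewrite mulrC E mulrC; apply: idealM => //; exact: pP.1.
Qed.

Lemma loc_contr_ideal M : is_proper_ideal M -> is_proper_ideal (loc_contr M).
Proof.
move=> Mi; apply/proper_idealP; split; rewrite /loc_contr /=.
- by rewrite to_loc0; exact: ideal0.
- by rewrite to_loc1; exact: ideal1.
- by move=> a u v Mu Mv; rewrite to_locD to_locM; apply: idealD => //; exact: idealM.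
Qed.

Lemma loc_contr_disjoint M s : is_proper_ideal M -> loc_contr M s ->
  ~ mult_set S s.
Proof.
move=> Mi Ms /to_loc_inv[y ys]; apply: (ideal1 Mi).
by rewrite -ys; apply: idealM.
Qed.

Lemma loc_contr_nonzero M : is_proper_ideal M -> nonzero_ideal M ->
  nonzero_ideal (loc_contr M).
Proof.
move=> Mi [x Mx x0]; have [a [s [Ss xE]]] := loc_fraction x.
exists a; first by apply/(loc_contr_frac Mi Ss xE).
exact: (loc_num_neq0 Ss xE x0).
Qed.

Lemma loc_contr_prime W : is_prime_ideal W -> is_prime_ideal (loc_contr W).
Proof.
move=> /prime_idealP[Wi WM]; apply/prime_idealP.
split=> [|u v]; first exact: loc_contr_ideal.
by rewrite /loc_contr /= to_locM => /WM.
Qed.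

Lemma loc_contr_sub M W : is_proper_ideal M -> is_proper_ideal W ->
  loc_contr M `<=` loc_contr W -> M `<=` W.
Proof.
move=> Mi Wi MW x Mx; have [a [s [Ss xE]]] := loc_fraction x.
by apply/(loc_contr_frac Wi Ss xE)/MW/(loc_contr_frac Mi Ss xE).
Qed.

Lemma loc_contr_inj M W : is_proper_ideal M -> is_proper_ideal W ->
  loc_contr M = loc_contr W -> M = W.
Proof.
by move=> Mi Wi E; apply/seteqP; split; apply: loc_contr_sub => //; rewrite E.
Qed.

Section PrimeExtension.
Variable P : set R.
Hypotheses (pP : is_prime_ideal P) (PS : forall t, P t -> ~ mult_set S t).

Lemma loc_extK : loc_contr (loc_ext P) = P.
Proof.
apply/seteqP; split=> a; rewrite /loc_contr /= (@loc_extP P _ a 1) //;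
  by [exact: mult_set1|rewrite to_loc1 mulr1].
Qed.

Lemma loc_ext_ideal : is_proper_ideal (loc_ext P).
Proof.
have [Pi _] := pP; have S1 := mult_set1 S.
apply/proper_idealP; split.
- by apply/(@loc_extP P 0 0 1); rewrite // ?mul0r ?to_loc0 //; exact: ideal0.
- move=> /(@loc_extP P 1 1 1 pP PS S1); rewrite mul1r => /(_ erefl).
  exact: ideal1.
move=> z u v Pu Pv.
have [a [s [Ss zE]]] := loc_fraction z.
have [b [t [St uE]]] := loc_fraction u.
have [c [r [Sr vE]]] := loc_fraction v.
(* This is [z * u + v] over the common denominator. *)
apply/(@loc_extP P _ (a * b * r + c * (s * t)) (s * t * r)) => //.
- by do ?apply: mult_setM.
- by rewrite to_locD !to_locM -zE -uE -vE; exact: frac_lin.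
apply: idealD => //; last first.
  by rewrite mulrC; apply: idealM => //; apply/(loc_extP pP PS Sr vE).
rewrite mulrC; apply: idealM => //; apply: idealM => //.
by apply/(loc_extP pP PS St uE).
Qed.

Lemma loc_ext_prime : is_prime_ideal (loc_ext P).
Proof.
apply/prime_idealP; split=> [|u v Puv]; first exact: loc_ext_ideal.
have [b [t [St uE]]] := loc_fraction u.
have [c [r [Sr vE]]] := loc_fraction v.
have /prime_idealP[_ PM] := pP.
have : P (b * c).
  have E : u * v * to_loc (t * r) = to_loc (b * c).
    by rewrite !to_locM -uE -vE -!mulrA; congr (_ * _); rewrite mulrCA.
  by apply/(loc_extP pP PS (mult_setM St Sr) E).
case/PM => ?; [left; exact/(loc_extP pP PS St uE)|right; exact/(loc_extP pP PS Sr vE)].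
Qed.

End PrimeExtension.

End LocIdeals.

(** * Maximal ideals of the localization at [N_v], and independence *)

Section NvLocalization.
Variable D : idomainType.
Local Notation L := (localization (Nv D)).
Local Notation contr := (@loc_contr _ (Nv D)).
Local Notation ext := (@loc_ext _ (Nv D)).
Implicit Types (P : set D) (M N : set {poly D}).

(** A proper ideal above the extension contracts to an ideal avoiding [N_v], hence inside some
    [P'[X]]; then [P] is inside [P'], so they agree. *)
Lemma Max_loc_ext P : tMax P -> Max (ext (poly_ext P)).
Proof.
move=> tP; have pP := prime_poly_ext (tMax_prime tP).
have PNv t : poly_ext P t -> ~ mult_set (Nv D) t by exact: poly_ext_Nv.
have Pi := loc_ext_ideal pP PNv; split=> // I Ii PI.
have [d Pd d0] : nonzero_ideal P by have [/t_idealP[]] := tP.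
have PcI : poly_ext P `<=` contr I.
  by rewrite -{1}(loc_extK pP PNv) => f; exact: PI.
have cIi := loc_contr_ideal Ii.
have Pcd : poly_ext P d%:P.
  by rewrite -[poly_ext P _]/(contraction (poly_ext P) d)
    (poly_extK (ideal0 (tMax_ideal tP))).
have cI0 : nonzero_ideal (contr I).
  by exists d%:P; rewrite ?polyC_eq0 //; exact: PcI.
have [f|P' tP' IP'] := sub_poly_ext cIi cI0; first exact: loc_contr_disjoint.
apply: loc_contr_inj => //; rewrite loc_extK //.
apply/seteqP; split=> // f /IP'.
suff -> : P' = P by [].
apply: (tMax_max tP tP'.1) => c.
rewrite -{1}(poly_extK (ideal0 (tMax_ideal tP))).
by rewrite -(poly_extK (ideal0 (tMax_ideal tP'))) => /PcI/IP'.
Qed.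

(** If [D] is a field, so is the localization, and its maximal ideal is zero; hence the assumption
    on [M]. Otherwise put, a nonzero [M] lies in the extension of some [P[X]], which is proper, so
    the two coincide. *)
Lemma loc_contr_Max (M : set L) : Max M -> nonzero_ideal M ->
  exists2 P, tMax P & contr M = poly_ext P.
Proof.
move=> [Mi Mmax] M0; have cM0 := loc_contr_nonzero Mi M0.
have [f|P tP MP] := sub_poly_ext (loc_contr_ideal Mi) cM0.
  exact: loc_contr_disjoint.
exists P => //; have pP := prime_poly_ext (tMax_prime tP).
have PNv t : poly_ext P t -> ~ mult_set (Nv D) t by exact: poly_ext_Nv.
rewrite -{1}(Mmax (ext (poly_ext P))) ?loc_extK //; first exact: loc_ext_ideal.
by apply: loc_contr_sub => //; rewrite ?loc_extK //; exact: loc_ext_ideal.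
Qed.

Lemma independent_uppers : independent (@tMax D) ->
  (forall Q : set {poly D}, is_upper_to_zero Q ->
     exists! M : set {poly D}, tMax M /\ Q `<=` M) ->
  independent (@tMax {poly D}).
Proof.
move=> indD uniqQ M N tM tN MN [W [pW W0 WM WN]].
(* If [W] meets [D] in zero, it is itself an upper to zero, and uniqueness identifies [M] and
   [N]. *)
have [Wc|/existsNP[d /not_implyP[Wd /eqP d0]]] :=
  pselect (forall a : D, W a%:P -> a = 0).
  have [M0 [_ uM]] := uniqQ W (And3 pW W0 Wc).
  by apply: MN; rewrite -(uM M) // -(uM N).
(* Otherwise [M] and [N] contain a nonzero constant, so both are extended from [D], and [W]
   contracts to a common nonzero prime. *)
have tcase M' : tMax M' -> W `<=` M' -> exists2 P, tMax P & M' = poly_ext P.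
  by move=> /tMax_poly_cases[M'0 /(_ _ Wd)/M'0 dE|//]; rewrite dE eqxx in d0.
have [P tP ME] := tcase M tM WM; have [P' tP' NE] := tcase N tN WN.
apply: (indD P P') => //; first by move=> PP'; apply: MN; rewrite ME NE PP'.
exists (contraction W); split; [exact: contraction_prime|by exists d| |].
  by rewrite -(poly_extK (ideal0 (tMax_ideal tP))) -ME => c /WM.
by rewrite -(poly_extK (ideal0 (tMax_ideal tP'))) -NE => c /WN.
Qed.

Lemma independent_tMax_poly : independent (@tMax {poly D}) ->
  independent (@tMax D) /\
  (forall Q : set {poly D}, is_upper_to_zero Q ->
     exists! M : set {poly D}, tMax M /\ Q `<=` M).
Proof.
move=> ind; split=> [P P' tP tP' PP' [W [pW [d Wd d0] WP WP']]|Q uQ].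
  have W00 := ideal0 pW.1.
  apply: (ind (poly_ext P) (poly_ext P')); try exact: tMax_poly_ext.
    move=> E; apply: PP'; rewrite -(poly_extK (ideal0 (tMax_ideal tP))) E.
    exact: poly_extK (ideal0 (tMax_ideal tP')).
  exists (poly_ext W); split; first exact: prime_poly_ext.
  - exists d%:P; rewrite ?polyC_eq0 //.
    by move=> i; rewrite coefC; case: eqP.
  - by move=> f Wf i; exact/WP/Wf.
  - by move=> f Wf i; exact/WP'/Wf.
have [M tM QM] := exists_tMax_upper uQ.
exists M; split=> // N [tN QN]; apply: contrapT => MN.
by case: uQ => pQ Q0 _; apply: (ind M N) => //; exists Q.
Qed.

Lemma independent_Max_loc : independent (@tMax {poly D}) ->
  independent (@Max L).
Proof.
move=> ind M N mM mN MN [W [pW W0 WM WN]].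
have nz (I : set L) : W `<=` I -> nonzero_ideal I.
  by case: W0 => x Wx x0 WI; exists x => //; exact: WI.
have [P tP ME] := loc_contr_Max mM (nz _ WM).
have [P' tP' NE] := loc_contr_Max mN (nz _ WN).
apply: (ind (contr M) (contr N)).
- by rewrite ME; exact: tMax_poly_ext.
- by rewrite NE; exact: tMax_poly_ext.
- by move=> E; apply: MN; apply: loc_contr_inj => //; [case: mM|case: mN].
exists (contr W); split.
- exact: loc_contr_prime.
- by apply: loc_contr_nonzero => //; exact: pW.1.
- by move=> f /WM.
- by move=> f /WN.
Qed.

Lemma independent_tMax_poly_loc : independent (@Max L) ->
  independent (@tMax {poly D}).
Proof.
move=> ind M N tM tN MN [W [pW W0 WM WN]].
(* If [M'] were an upper to zero, it would equal [W] by minimality and so lie in [N'], against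
   maximality. *)
have tcase M' N' : tMax M' -> tMax N' -> M' <> N' -> W `<=` M' -> W `<=` N' ->
    exists2 P, tMax P & M' = poly_ext P.
  move=> tM' tN' MN' WM' WN'; have [M'c|//] := tMax_poly_cases tM'.
  have [/t_idealP[_ M'0 _] _] := tM'.
  have uM' : is_upper_to_zero M' by split=> //; exact: tMax_prime.
  have WE := upper_minimal uM' pW W0 WM'.
  by case: MN'; apply/esym/(tMax_max tM' tN'.1); rewrite -WE.
have [P tP ME] := tcase M N tM tN MN WM WN.
have [P' tP' NE] := tcase N M tN tM (fun E => MN (esym E)) WN WM.
have disj I : I `<=` M -> forall t, I t -> ~ mult_set (Nv D) t.
  by rewrite ME => IM t /IM; exact: poly_ext_Nv.
have disjN t : N t -> ~ mult_set (Nv D) t by rewrite NE; exact: poly_ext_Nv.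
have pM := tMax_prime tM; have pN := tMax_prime tN.
apply: (ind (ext M) (ext N)).
- by rewrite ME; exact: Max_loc_ext.
- by rewrite NE; exact: Max_loc_ext.
- move=> E; apply: MN; rewrite -(loc_extK pM (disj _ (@subset_refl _ _))) E.
  exact: loc_extK.
exists (ext W); split.
- by apply: loc_ext_prime => //; exact: disj.
- have [x Wx x0] := W0; exists (to_loc _ x); last by rewrite to_loc_eq0.
  by rewrite -[ext W _]/(contr (ext W) x) loc_extK //; exact: disj.
- by move=> x [a [s [/WM Wa Ss xE]]]; exists a, s.
- by move=> x [a [s [/WN Wa Ss xE]]]; exists a, s.
Qed.

(** * Finite character *)

Lemma finite_tMax_poly : finite_character (@tMax D) ->
  finite_character (@tMax {poly D}).
Proof.
move=> fin h h0.
(* A maximal t-ideal containing [h] is an upper to zero, or [P[X]] with the leading coefficient of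
   [h] in [P]. *)
apply: (@sub_finite_set _ _ ([set Q | is_upper_to_zero Q /\ Q h] `|`
    @poly_ext D @` [set P | tMax P /\ P (lead_coef h)])); last first.
  rewrite finite_setU; split; first exact: finite_uppers.
  by apply/finite_image/fin; rewrite lead_coef_eq0.
move=> M [tM Mh]; have [Mc|[P tP ME]] := tMax_poly_cases tM; [left|right].
  split=> //; have [/t_idealP[_ M0 _] _] := tM.
  by split=> //; exact: tMax_prime.
by exists P => //; split=> //; rewrite ME in Mh; exact: Mh.
Qed.

Lemma finite_Max_loc : finite_character (@tMax {poly D}) ->
  finite_character (@Max L).
Proof.
move=> fin x x0; have [a [s [Ss xE]]] := loc_fraction x.
have a0 := loc_num_neq0 Ss xE x0.
(* Each [M] containing [x] is the extension of its contraction, a maximal t-ideal containing the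
   numerator [a]. *)
apply: (@sub_finite_set _ _ (ext @` [set M | tMax M /\ M a])); last first.
  exact/finite_image/fin.
move=> M [mM Mx]; have [Mi _] := mM.
have [|P tP ME] := loc_contr_Max mM; first by exists x.
have tcM : tMax (contr M) by rewrite ME; exact: tMax_poly_ext.
exists (contr M); first by split=> //; apply/(loc_contr_frac Mi Ss xE).
have cMNv t : contr M t -> ~ mult_set (Nv D) t by exact: loc_contr_disjoint.
have pM := tMax_prime tcM.
by apply: loc_contr_inj => //; [exact: loc_ext_ideal|exact: loc_extK].
Qed.

Lemma finite_tMax_loc : finite_character (@Max L) ->
  finite_character (@tMax D).
Proof.
move=> fin d d0.
(* Contracting twice recovers [P] from its extension, so finitely many maximal ideals account for
   all [P] containing [d]. *)
apply: (@sub_finite_set _ _ ((fun I : set L => contraction (contr I)) @`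
    [set I : set L | Max I /\ I (to_loc (Nv D) d%:P)])); last first.
  by apply/finite_image/fin; rewrite to_loc_eq0 polyC_eq0.
move=> P [tP Pd]; have pP := prime_poly_ext (tMax_prime tP).
have PNv t : poly_ext P t -> ~ mult_set (Nv D) t by exact: poly_ext_Nv.
have E : contraction (contr (ext (poly_ext P))) = P.
  by rewrite (loc_extK pP PNv) (poly_extK (ideal0 (tMax_ideal tP))).
exists (ext (poly_ext P)) => //; split; first exact: Max_loc_ext.
by rewrite -[ext _ _]/(contraction (contr (ext (poly_ext P))) d) E.
Qed.

End NvLocalization.

Theorem proposition2p2 (D : idomainType) :
  [<-> independent (@tMax D) /\
       (forall Q : set {poly D}, is_upper_to_zero Q ->
          exists! M : set {poly D}, tMax M /\ Q `<=` M);
       independent (@tMax {poly D});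
       independent (@Max (localization (Nv D)))]
  /\
  [<-> weakly_Matlis D /\
       (forall Q : set {poly D}, is_upper_to_zero Q ->
          exists! M : set {poly D}, tMax M /\ Q `<=` M);
       weakly_Matlis {poly D};
       h_local (localization (Nv D))].
Proof.
split; tfae.
- by move=> [indD uniqQ]; exact: independent_uppers.
- exact: independent_Max_loc.
- by move=> /independent_tMax_poly_loc/independent_tMax_poly.
- move=> [[indD finD] uniqQ]; split; first exact: independent_uppers.
  exact: finite_tMax_poly.
- move=> [indDX finDX]; split; first exact: independent_Max_loc.
  exact: finite_Max_loc.
move=> [/independent_tMax_poly_loc/independent_tMax_poly[indD uniqQ] finL].
by split=> //; split=> //; exact: finite_tMax_loc.
Qed.
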